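(* Let $A$ be the power series ring $\mathbb F[[u,v,w,x,y,z]]$, where $\mathbb F$ is a field of characteristic $p>0$. Let $I$ be the ideal of $A$ generated by $\Delta_1=vz-wy$, $\Delta_2=wx-uz$, and $\Delta_3=uy-vx$. (1) For $q=p^e$ (with $e\ge 0$ an integer) and nonnegative integers $s,t$ with $s+t\le q-1$, one has $$y^sz^t(\Delta_2\Delta_3)^{q-1}\ \in\ I^{[q]}+x^{s+t}A .$$ (2) For $q,s,t$ as in (1), let $f_{s,t}$ be an element of $A$ with $$y^sz^t(\Delta_2\Delta_3)^{q-1}\ \equiv\ x^{s+t}f_{s,t}\pmod{I^{[q]}} .$$ Then $f_{s,t}$ is well-defined modulo $I^{[q]}$. Moreover, $f_{s,t}\in I^{[q]}:_AI$, and $$I^{[q]}:_AI\ =\ I^{[q]}+\big(f_{s,t}\mid s,t\ge0,\ s+t\le q-1\big)A .$$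
   Context: For an ideal $I$ of $A$ and $q=p^e$, $I^{[q]}$ denotes the Frobenius power, the ideal generated by the $q$-th powers of elements of $I$; and $I^{[q]}:_AI=\{a\in A\mid aI\subseteq I^{[q]}\}$. *)

(* Defs.v *)
From HB Require Import structures.
From mathcomp Require Import all_boot all_order all_algebra.
From mathcomp Require Import boolp classical_sets.
From mathcomp Require Import mpoly.

Set Implicit Arguments.
Unset Strict Implicit.
Unset Printing Implicit Defensive.

Import GRing.Theory.
Local Open Scope ring_scope.

(* The ring R[[X_0, ..., X_(n-1)]]. A power series is its family of
   coefficients, indexed by the monomials 'X_{1..n} of multinomials, with no
   finiteness condition on the support. *)
Record mpseries (n : nat) (R : Type) := MPSeries { mpscoef : 'X_{1..n} -> R }.

Section PowerSeries.
Variables (n : nat) (R : comNzRingType).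
Implicit Types (f g h : mpseries n R) (m : 'X_{1..n}).

Lemma mpsP f g : (forall m, mpscoef f m = mpscoef g m) -> f = g.
Proof. by case: f => f; case: g => g /= fg; congr MPSeries; apply/funext. Qed.

HB.instance Definition _ := gen_eqMixin (mpseries n R).
HB.instance Definition _ := gen_choiceMixin (mpseries n R).

Definition mps_zero : mpseries n R := MPSeries (fun _ => 0).
Definition mps_one : mpseries n R := MPSeries (fun m => (m == 0%MM)%:R).
Definition mps_opp f : mpseries n R := MPSeries (fun m => - mpscoef f m).
Definition mps_add f g : mpseries n R :=
  MPSeries (fun m => mpscoef f m + mpscoef g m).
(* Cauchy product: the sum ranges over all pairs of monomials of product m;
   the degree bound (which such pairs satisfy) only makes the type finite. *)
Definition mps_mul f g : mpseries n R :=
  MPSeries (fun m =>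
    \sum_(k : 'X_{1..n < (mdeg m).+1, (mdeg m).+1} | m == (k.1 + k.2)%MM)
      mpscoef f k.1 * mpscoef g k.2).
Definition mpsX (i : 'I_n) : mpseries n R :=
  MPSeries (fun m => (m == U_(i)%MM)%:R).

Fact mps_addA : associative mps_add.
Proof. by move=> f g h; apply/mpsP => m /=; rewrite addrA. Qed.

Fact mps_addC : commutative mps_add.
Proof. by move=> f g; apply/mpsP => m /=; rewrite addrC. Qed.

Fact mps_add0 : left_id mps_zero mps_add.
Proof. by move=> f; apply/mpsP => m /=; rewrite add0r. Qed.

Fact mps_addN : left_inverse mps_zero mps_opp mps_add.
Proof. by move=> f; apply/mpsP => m /=; rewrite addNr. Qed.

HB.instance Definition _ := GRing.isZmodule.Build (mpseries n R)
  mps_addA mps_addC mps_add0 mps_addN.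

(* The remaining ring axioms are inherited from {mpoly R[n]} by truncation. *)
Definition mps_trunc (d : nat) f : {mpoly R[n]} :=
  \sum_(m : 'X_{1..n < d}) mpscoef f m *: 'X_[m].

Lemma mcoeff_mps_trunc d f m :
  (mdeg m < d)%N -> (mps_trunc d f)@_m = mpscoef f m.
Proof. exact: mcoeff_mpoly. Qed.

Lemma mpscoefM_trunc d f g m : (mdeg m < d)%N ->
  mpscoef (mps_mul f g) m = (mps_trunc d f * mps_trunc d g)@_m.
Proof.
move=> md; rewrite mcoeffM; apply: eq_bigr => -[k1 k2] /= _.
by rewrite !mcoeff_mps_trunc // (leq_trans (bmdeg _)).
Qed.

Lemma eq_mcoeffM (p p' r r' : {mpoly R[n]}) m :
    (forall k : 'X_{1..n}, (mdeg k <= mdeg m)%N -> p@_k = p'@_k) ->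
    (forall k : 'X_{1..n}, (mdeg k <= mdeg m)%N -> r@_k = r'@_k) ->
  (p * r)@_m = (p' * r')@_m.
Proof.
move=> pp' rr'; rewrite !mcoeffM; apply: eq_bigr => -[k1 k2] /= _.
by rewrite pp' ?rr' // -ltnS bmdeg.
Qed.

Fact mps_mulA : associative mps_mul.
Proof.
move=> f g h; apply/mpsP => m; have md := ltnSn (mdeg m).
rewrite !(mpscoefM_trunc _ _ md).
transitivity ((mps_trunc (mdeg m).+1 f *
   (mps_trunc (mdeg m).+1 g * mps_trunc (mdeg m).+1 h))@_m).
  by apply: eq_mcoeffM => // k km; rewrite mcoeff_mps_trunc // (@mpscoefM_trunc (mdeg m).+1).
rewrite mulrA; apply: eq_mcoeffM => // k km.
by rewrite mcoeff_mps_trunc // (@mpscoefM_trunc (mdeg m).+1).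
Qed.

Fact mps_mulC : commutative mps_mul.
Proof.
move=> f g; apply/mpsP => m; have md := ltnSn (mdeg m).
by rewrite !(mpscoefM_trunc _ _ md) mulrC.
Qed.

Fact mps_mul1 : left_id mps_one mps_mul.
Proof.
move=> f; apply/mpsP => m; have md := ltnSn (mdeg m).
rewrite (mpscoefM_trunc _ _ md) -[RHS](mcoeff_mps_trunc _ md).
rewrite -[in RHS](mul1r (mps_trunc _ f)).
by apply: eq_mcoeffM => // k km; rewrite mcoeff_mps_trunc // mcoeff1.
Qed.

Fact mps_mulDl : left_distributive mps_mul mps_add.
Proof.
move=> f g h; apply/mpsP => m /=; rewrite -big_split /=.
by apply: eq_bigr => k _; rewrite mulrDl.
Qed.

Fact mps_oner_neq0 : mps_one != 0.
Proof.
apply/eqP => /(congr1 (fun f => mpscoef f 0%MM)) /= /eqP.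
by rewrite eqxx oner_eq0.
Qed.

HB.instance Definition _ := GRing.Zmodule_isComNzRing.Build (mpseries n R)
  mps_mulA mps_mulC mps_mul1 mps_mulDl mps_oner_neq0.

End PowerSeries.

Arguments mpsX {n} R i.

Local Open Scope classical_set_scope.

Section Ideals.
Variable R : comNzRingType.
Implicit Types (S I J : set R) (a b : R).

Definition ideal_gen S : set R :=
  [set a | exists (k : nat) (c g : 'I_k -> R),
     (forall i, S (g i)) /\ a = \sum_(i < k) c i * g i].

Definition ideal_add I J : set R := [set a + b | a in I & b in J].

Definition frobenius_power (q : nat) I : set R :=
  ideal_gen [set a ^+ q | a in I].

(* J :_R I *)
Definition ideal_colon J I : set R := [set a | forall b, I b -> J (a * b)].

Definition eqmod_ideal J a b : Prop := J (a - b).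

End Ideals.

(* Main.v *)
Require Import Defs.
From mathcomp Require Import all_boot all_order all_algebra.
From mathcomp Require Import boolp classical_sets.
From mathcomp Require Import mpoly ring zify.

(** Write a, b, c for the three minors of the matrix with rows (u, v, w) and
(x, y, z), put q = n + 1, and let Iq be the Frobenius power of I = (a, b, c).
Since q is a power of the characteristic, Iq = (a^q, b^q, c^q), and these
generators are the minors of the matrix of q-th powers.  The proof rests on the
two relations ua + vb + wc = 0 and xa + yb + zc = 0 between the rows.

That x^(s+t) divides y^s z^t (bc)^n modulo Iq is seen on the binomial expansion
of b^n = (wx - uz)^n and c^n = (uy - vx)^n ([x_divides]): a term with fewer than
s + t <= n factors x contains u^q y^q or u^q z^q, which are congruent to
v^q x^q and w^q x^q modulo Iq.  The quotient is unique modulo Iq because x is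
regular modulo Iq ([minors_nzd], [variable_nzd_minors]), and it multiplies I
into Iq because (bc)^n does: this is plain for b and c, and xa lies in (b, c)
([bc_colon]).

It remains to show that these quotients generate the colon ideal.  Let g
multiply I into Iq.  As b, c is a regular sequence ([minor_nzd_mod_minor]), the
colon of (b^q, c^q) by (b, c) is (b^q, c^q, (bc)^n) ([colon_regular_powers]);
as xa and ua lie in (b, c), both x^q g and u^q g lie in Iq + ((bc)^n)
([colon_multiple]).  Say x^q g = h (bc)^n modulo Iq.  Two constraints on h are
found.
- Grade A by the degree in x, y, z, for which a, b, c have degree 1 and u has
  degree 0.  The low part of u^q g = i + k (bc)^n shows that, modulo Iq, g has
  order at least 2n, so that h may be taken of order at least 3n + 1 - 2n = q:
  h lies in (x, y, z)^q.
- Multiplying by y^n and using that (yb)^n c^n and (-xa)^n c^n agree modulo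
  c^q, one may cancel x^n and work modulo x; there everything becomes explicit
  and gives that h lies in (x, u, a) ([numerator_in_xua]).

Together, h lies in x (x, y, z)^n + u (x, y, z)^q + I, and since uy and uz are
congruent to vx and wx modulo I, in x (x, y, z)^n + I.  But for r + s + t = n,
x x^r y^s z^t (bc)^n is congruent to x^q f_(s,t).  Cancelling x^q expresses g
by the f_(s,t) ([colon_generated]).

Congruences modulo ideals generated by powers of variables are read off from
the coefficients: such an ideal consists of the series supported on an
up-closed set of monomials. *)

Set Implicit Arguments.
Unset Strict Implicit.
Unset Printing Implicit Defensive.

Import GRing.Theory.
Local Open Scope ring_scope.

(** * Coefficients of power series *)

Section SeriesCoefficients.
Variables (n : nat) (R : comNzRingType).
Implicit Types (f g h : mpseries n R) (m : 'X_{1..n}) (P Q : pred 'X_{1..n}).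

Lemma mpscoefD f g m : mpscoef (f + g) m = mpscoef f m + mpscoef g m.
Proof. by []. Qed.

Lemma mpscoefB f g m : mpscoef (f - g) m = mpscoef f m - mpscoef g m.
Proof. by []. Qed.

Lemma mpscoefMX f i m :
  mpscoef (f * mpsX R i) m =
    if (0 < m i)%N then mpscoef f (m - U_(i))%MM else 0.
Proof.
have md := ltnSn (mdeg m).
rewrite (mpscoefM_trunc _ _ md).
transitivity ((mps_trunc (mdeg m).+1 f * 'X_[U_(i)])@_m).
  apply: eq_mcoeffM => // k km.
  by rewrite mcoeff_mps_trunc // mcoeffX eq_sym.
case: ifPn => mi.
  have le1 : (U_(i) <= m)%MM.
    by apply/mnm_lepP => j; rewrite mnm1E; case: eqP => [<-|].
  transitivity (mps_trunc (mdeg m).+1 f)@_(m - U_(i)).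
    by rewrite -[RHS](mcoeffMX _ U_(i)%MM) addmC submK.
  by rewrite mcoeff_mps_trunc // ltnS -{2}(submK le1) mdegD leq_addr.
rewrite mcoeffM big1 // => -[k1 k2] /= /eqP mE; rewrite mcoeffX.
case: eqP => [k2E|]; last by rewrite mulr0.
have := congr1 (fun m : 'X_{1..n} => m i) mE.
by rewrite mnmDE -k2E mnm1E eqxx; lia.
Qed.

Lemma mpscoefMXn f i k m :
  mpscoef (f * mpsX R i ^+ k) m =
  if (k <= m i)%N then mpscoef f (m - U_(i) *+ k)%MM else 0.
Proof.
elim: k f m => [|k IH] f m; first by rewrite expr0 mulr1 mulm0n subm0.
rewrite exprS mulrA IH mpscoefMX mnmBE mulmnE mnm1E eqxx mul1n subn_gt0.
case: (leqP k (m i)) => [kmi|/ltnW mik]; last by rewrite ltnNge mik.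
case: ifP => // _; congr mpscoef; apply/mnmP => j.
by rewrite !(mnmBE, mulmnE, mnm1E) mulnS -subnDA addnC.
Qed.

Lemma mpscoefMXnD f i k m :
  mpscoef (f * mpsX R i ^+ k) (m + U_(i) *+ k)%MM = mpscoef f m.
Proof. by rewrite mpscoefMXn mnmDE mulmnE mnm1E eqxx mul1n leq_addl addmK. Qed.

Lemma mpscoefMXD f i m : mpscoef (f * mpsX R i) (m + U_(i))%MM = mpscoef f m.
Proof. by have := mpscoefMXnD f i 1 m; rewrite expr1 mulm1n. Qed.

Lemma mpsXn_inj f g i k : f * mpsX R i ^+ k = g * mpsX R i ^+ k -> f = g.
Proof.
by move=> fg; apply/mpsP => m; rewrite -(mpscoefMXnD f i k) fg mpscoefMXnD.
Qed.

Definition supported P f := forall m, ~~ P m -> mpscoef f m = 0.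

Definition upclosed P := forall m m', P m -> P (m + m')%MM.

Lemma supportedD P f g : supported P f -> supported P g -> supported P (f + g).
Proof. by move=> Pf Pg m Pm; rewrite mpscoefD Pf // Pg // addr0. Qed.

Lemma supportedMl P f g : upclosed P -> supported P g -> supported P (f * g).
Proof.
move=> upP Pg m Pm; rewrite (_ : mpscoef (f * g) m =
  \sum_(k : 'X_{1..n < (mdeg m).+1, (mdeg m).+1} | m == (k.1 + k.2)%MM)
      mpscoef f k.1 * mpscoef g k.2) //.
rewrite big1 // => -[k1 k2] /= /eqP mE; rewrite Pg ?mulr0 //.
apply: contra Pm => Pk2; suff : P (k2 + k1)%MM by rewrite addmC -mE.
exact: upP.
Qed.

Lemma supported_sub P Q f : {subset P <= Q} -> supported P f -> supported Q f.
Proof. by move=> PQ Pf m Qm; apply: Pf; apply: contra Qm => /PQ. Qed.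

Lemma supportedXn P i k :
  P (U_(i) *+ k)%MM -> supported P (mpsX R i ^+ k).
Proof.
move=> Pi m Pm; rewrite -[_ ^+ _]mul1r mpscoefMXn.
case: ifP => // kmi.
rewrite (_ : mpscoef 1 _ = ((m - U_(i) *+ k)%MM == 0%MM)%:R) //.
case: eqP => // m0; case/negP: Pm; move: Pi; congr P.
apply/mnmP => j; have := congr1 (fun m : 'X_{1..n} => m j) m0.
rewrite !(mnmBE, mulmnE, mnm1E, mnm0E); case: eqP => [<-|_]; last lia.
by move: kmi; lia.
Qed.

Lemma supportedMXnK P Q i k f :
  (forall m, Q (m + U_(i) *+ k)%MM -> P m) ->
  supported Q (f * mpsX R i ^+ k) -> supported P f.
Proof.
move=> QP Qf m Pm; rewrite -(mpscoefMXnD f i k); apply: Qf.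
by apply: contra Pm => /QP.
Qed.

(** Division by a power of a variable.  Iterated with smaller and smaller Q, it
writes a series supported on P as a combination of powers of variables. *)
Lemma supported_split P Q i k f :
  (forall m, P m -> (k <= m i)%N || Q m) -> supported P f ->
  exists g h, [/\ f = g * mpsX R i ^+ k + h,
                 supported (fun m => P (m + U_(i) *+ k)%MM) g & supported Q h].
Proof.
move=> PQ Pf.
exists (MPSeries (fun m => mpscoef f (m + U_(i) *+ k)%MM)).
exists (MPSeries (fun m => if (k <= m i)%N then 0 else mpscoef f m)).
split=> [|m Pm|m Qm].
- apply/mpsP => m; rewrite mpscoefD mpscoefMXn /=.
  case: ifPn => kmi; last by rewrite add0r.
  rewrite addr0 submK //; apply/mnm_lepP => j.
  by rewrite mulmnE mnm1E; case: eqP => [<-|_]; rewrite ?mul1n.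
- exact: Pf.
- rewrite /=; case: ifPn => // kmi; apply: Pf.
  by apply/negP => /PQ; rewrite (negPf kmi) (negPf Qm).
Qed.

Lemma supported0 f : supported pred0 f -> f = 0.
Proof. by move=> f0; apply/mpsP => m; rewrite f0. Qed.

(** For m outside P, the vanishing of the product at m X_i X_j says that the
coefficient of f at m equals the one at m X_i X_j / (X_k X_l), or is zero when
this is not a monomial.  The exponent of X_k is smaller there, which allows an
induction. *)
Lemma supported_binomialK P i j k l f :
  upclosed P -> (forall m, P (m + U_(i) + U_(j))%MM -> P m) ->
  k != i -> k != j -> k != l ->
  supported P (f * (mpsX R i * mpsX R j - mpsX R k * mpsX R l)) ->
  supported P f.
Proof.
move=> upP Pij ki kj kl Pf m.
have [d] := ubnP (m k); elim: d m => // d IH m mkd Pm.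
have := Pf (m + U_(i) + U_(j))%MM; rewrite mulrBr mpscoefB !mulrA mpscoefMXD.
move=> /(_ (contra (@Pij m) Pm)).
rewrite mpscoefMXD => /subr0_eq ->.
set M := (m + _ + _)%MM.
rewrite !mpscoefMX mnmBE mnm1E eq_sym (negPf kl) subn0.
case: ifPn => // Ml; case: ifPn => // Mk.
have MkE : M k = m k.
  by rewrite !mnmDE !mnm1E ![_ == k]eq_sym (negPf ki) (negPf kj) !addn0.
apply: IH.
  by rewrite !mnmBE !mnm1E eqxx [_ == k]eq_sym (negPf kl); lia.
apply: contra Pm => PM; apply: Pij; rewrite -/M.
rewrite (_ : M = ((M - U_(l) - U_(k)) + (U_(l) + U_(k)))%MM); first exact: upP.
apply/mnmP => r; rewrite !(mnmBE, mnmDE, mnm1E).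
case: (l =P r) => [lr|_]; case: (k =P r) => [kr|_]; rewrite ?mnmDE ?mnm1E.
- by move: kl; rewrite lr kr eqxx.
- by move: Ml; rewrite -lr !mnmDE !mnm1E; lia.
- by move: Mk; rewrite -kr !mnmDE !mnm1E; lia.
- by lia.
Qed.
End SeriesCoefficients.

(** * Monomial ideals *)

Section MonomialIdeals.
Variables (n : nat) (R : comNzRingType).
Implicit Types (f g h : mpseries n R) (m : 'X_{1..n}) (s : seq ('I_n * nat)).

(** The monomials of the ideal generated by the X_i ^ k for (i, k) in s. *)
Definition above s : pred 'X_{1..n} := 
  fun m => has (fun ik => ik.2 <= m ik.1)%N s.

Lemma above_upclosed s : upclosed (above s).
Proof.
move=> m m' /hasP[ik iks ikm]; apply/hasP; exists ik => //.
by rewrite mnmDE; apply: leq_trans ikm (leq_addr _ _).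
Qed.

Lemma above_supported_cons i k s f :
  supported (above ((i, k) :: s)) f <->
  exists g h, f = g * mpsX R i ^+ k + h /\ supported (above s) h.
Proof.
split=> [fs|[g [h [-> hs]]]].
  have PQ m : above ((i, k) :: s) m -> (k <= m i)%N || above s m by [].
  by have [g [h [fE _ hs]]] := supported_split PQ fs; exists g, h.
apply: supportedD.
  apply: supportedMl; first exact: above_upclosed.
  by apply: supportedXn; rewrite /above /= mulmnE mnm1E eqxx mul1n leqnn.
by apply: supported_sub hs => m ms; apply/orP; right.
Qed.

Lemma above_supported1 i k f :
  supported (above [:: (i, k)]) f <-> exists g, f = g * mpsX R i ^+ k.
Proof.
split=> [/above_supported_cons[g [h [-> /supported0->]]]|[g ->]].
  by exists g; rewrite addr0.
by apply/above_supported_cons; exists g, 0; rewrite addr0.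
Qed.

Lemma above_supported2 i k j l f :
  supported (above [:: (i, k); (j, l)]) f <->
  exists g h, f = g * mpsX R i ^+ k + h * mpsX R j ^+ l.
Proof.
split=> [/above_supported_cons[g [h [-> /above_supported1[h' ->]]]]|[g [h ->]]].
  by exists g, h'.
apply/above_supported_cons; exists g, (h * mpsX R j ^+ l); split=> //.
by apply/above_supported1; exists h.
Qed.

Lemma aboveMXn s i k m :
  i \notin unzip1 s -> above s (m + U_(i) *+ k)%MM = above s m.
Proof.
move=> is_; apply: eq_in_has => -[j l] jls /=.
rewrite mnmDE mulmnE mnm1E; case: eqP => [ij|_]; last by rewrite addn0.
by case/negP: is_; rewrite ij; apply/mapP; exists (j, l).
Qed.

Lemma above_variable_nzd s i k f : i \notin unzip1 s ->
  supported (above s) (f * mpsX R i ^+ k) -> supported (above s) f.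
Proof. by move=> is_; apply: supportedMXnK => m; rewrite aboveMXn. Qed.

Lemma above_binomial_nzd s i j k l e f :
  i \notin unzip1 s -> j \notin unzip1 s -> k \notin [:: i; j; l] ->
  supported (above s) (f * (mpsX R i * mpsX R j - mpsX R k * mpsX R l) ^+ e) ->
  supported (above s) f.
Proof.
rewrite !inE !negb_or => is_ js /and3P[ki kj kl].
elim: e f => [|e IH] f; first by rewrite expr0 mulr1.
rewrite exprS mulrA => /IH; apply: supported_binomialK => //.
  exact: above_upclosed.
by move=> m; have := aboveMXn 1 m is_; have := aboveMXn 1 (m + U_(i)) js;
  rewrite !mulm1n => -> ->.
Qed.
End MonomialIdeals.

(** * Two of the minors form a regular sequence *)

Section Division.
Variables (n : nat) (R : comNzRingType).
Implicit Types (f g h : mpseries n R) (m : 'X_{1..n}) (i j k l : 'I_n).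

Lemma mpscoefMXX f i j m :
  mpscoef (f * (mpsX R i * mpsX R j)) m =
  if (0 < m j)%N && (0 < (m - U_(j))%MM i)%N
  then mpscoef f (m - U_(j) - U_(i))%MM else 0.
Proof. by rewrite mulrA !mpscoefMX; case: ifP. Qed.

Lemma mpscoefMXXD f i j m :
  mpscoef (f * (mpsX R i * mpsX R j)) (m + U_(i) + U_(j))%MM = mpscoef f m.
Proof. by rewrite mulrA !mpscoefMXD. Qed.

(** Coefficients of the quotient by X_i X_j - X_k X_l when X_i X_j is rewritten
into X_k X_l as long as possible.  All monomials that are rewritten into a
given one contribute to its coefficient; each step back lowers the exponent of
X_k, whose value d bounds their number. *)
Fixpoint binomial_quo f i j k l (d : nat) m : R :=
  mpscoef f (m + U_(i) + U_(j))%MM +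
  if d is d'.+1 then
    if (0 < m l)%N then
      binomial_quo f i j k l d' (m + U_(i) + U_(j) - U_(l) - U_(k))%MM
    else 0
  else 0.

Lemma binomial_division f i j k l : uniq [:: i; j; k; l] ->
  exists g h, f = g * (mpsX R i * mpsX R j - mpsX R k * mpsX R l) + h
    /\ supported (fun m => ~~ ((0 < m i) && (0 < m j))%N) h.
Proof.
rewrite /= !inE !negb_or => /and4P[/and3P[ij ik il] /andP[jk jl] kl _].
pose g : mpseries n R := MPSeries (fun m => binomial_quo f i j k l (m k) m).
pose B := mpsX R i * mpsX R j - mpsX R k * mpsX R l.
exists g, (f - g * B); split=> [|M]; first by rewrite addrC subrK.
rewrite negbK => /andP[Mi Mj].
rewrite mulrBr !mpscoefB; pose m := (M - U_(i) - U_(j))%MM.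
have MkE : m k = M k by rewrite !mnmBE !mnm1E (negPf ik) (negPf jk) !subn0.
have MlE : m l = M l by rewrite !mnmBE !mnm1E (negPf il) (negPf jl) !subn0.
have -> : M = (m + U_(i) + U_(j))%MM.
  apply/mnmP => r; rewrite !(mnmBE, mnmDE, mnm1E).
  case: (i =P r) => [ir|_]; case: (j =P r) => [jr|_]; last by lia.
  - by rewrite ir jr eqxx in ij.
  - by rewrite -ir; lia.
  - by rewrite -jr; lia.
rewrite mpscoefMXXD mpscoefMXX mnmBE mnm1E [l == k]eq_sym (negPf kl) subn0.
have m'kE : (m + U_(i) + U_(j))%MM k = m k.
  by rewrite !mnmDE !mnm1E (negPf ik) (negPf jk) !addn0.
have m'lE : (m + U_(i) + U_(j))%MM l = m l.
  by rewrite !mnmDE !mnm1E (negPf il) (negPf jl) !addn0.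
have dE : (m + U_(i) + U_(j) - U_(l) - U_(k))%MM k = (m k).-1.
  rewrite mnmBE [X in (X - _)%N]mnmBE m'kE !mnm1E [l == k]eq_sym (negPf kl).
  by rewrite eqxx subn0 subn1.
rewrite {1}/g m'kE m'lE /= dE.
case: (m k) => [|d] /=; rewrite ?andbF ?addr0 ?subr0 ?subrr //.
by rewrite andbT; case: ifP => _; rewrite ?addr0 ?subr0 ?subrr // addrK subrr.
Qed.
End Division.

Local Notation iu := (@Ordinal 6 0 isT) (only parsing).
Local Notation iv := (@Ordinal 6 1 isT) (only parsing).
Local Notation iw := (@Ordinal 6 2 isT) (only parsing).
Local Notation ix := (@Ordinal 6 3 isT) (only parsing).
Local Notation iy := (@Ordinal 6 4 isT) (only parsing).
Local Notation iz := (@Ordinal 6 5 isT) (only parsing).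

Section RegularPair.
Variable R : comNzRingType.
Local Notation u := (mpsX R iu).
Local Notation v := (mpsX R iv).
Local Notation w := (mpsX R iw).
Local Notation x := (mpsX R ix).
Local Notation y := (mpsX R iy).
Local Notation z := (mpsX R iz).

(** The minors b and c form a regular sequence.  For the weight counting v and
z, their lowest parts are the coprime monomials wx and uy.  After division, r
may be assumed to have no monomial divisible by uy; then comparing the lowest
parts of both sides shows that r and s vanish weight after weight. *)
Lemma minor_nzd_mod_minor (r s : mpseries 6 R) :
  r * (w * x - u * z) = s * (u * y - v * x) ->
  exists t, r = t * (u * y - v * x).
Proof.
have [t [r0 [-> r0P]]] :=
  binomial_division r (i := iu) (j := iy) (k := iv) (l := ix) isT.
move=> rs; exists t; suff -> : r0 = 0 by rewrite addr0.
pose s0 := s - t * (w * x - u * z).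
have {rs} rs : r0 * (w * x - u * z) = s0 * (u * y - v * x).
  by rewrite /s0 mulrBl -rs; ring.
pose wt (m : 'X_{1..6}) := (m iv + m iz)%N.
suff rs0 d m : (wt m < d)%N -> mpscoef r0 m = 0 /\ mpscoef s0 m = 0.
  by apply/mpsP => m; case: (rs0 (wt m).+1 m).
elim: d m => // d IH.
have rsM M : mpscoef (r0 * (w * x)) M - mpscoef (r0 * (u * z)) M =
             mpscoef (s0 * (u * y)) M - mpscoef (s0 * (v * x)) M.
  by rewrite -!mpscoefB -!mulrBr rs.
have ruz M : (wt M < d.+1)%N -> mpscoef (r0 * (u * z)) M = 0.
  move=> Md; rewrite mpscoefMXX; case: ifP => // /andP[M1 M2].
  by apply: (IH _ _).1; move: Md M1 M2; rewrite /wt !mnmBE !mnm1E /=; lia.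
have svx M : (wt M < d.+1)%N -> mpscoef (s0 * (v * x)) M = 0.
  move=> Md; rewrite mpscoefMXX; case: ifP => // /andP[M1 M2].
  by apply: (IH _ _).2; move: Md M1 M2; rewrite /wt !mnmBE !mnm1E /=; lia.
have r00 m : (wt m < d.+1)%N -> mpscoef r0 m = 0.
  move=> md; have [uym|] := boolP ((0 < m iu) && (0 < m iy))%N.
    by apply: r0P; rewrite negbK.
  move=> uym; have := rsM (m + U_(iw) + U_(ix))%MM.
  have wM : (wt (m + U_(iw) + U_(ix))%MM < d.+1)%N.
    by move: md; rewrite /wt !mnmDE !mnm1E /=; lia.
  rewrite mpscoefMXXD ruz // svx // !subr0 => ->.
  rewrite mpscoefMXX; case: ifP => //.
  by rewrite !mnmBE !mnmDE !mnm1E /=; move: uym; lia.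
move=> m md; split; first exact: r00.
have := rsM (m + U_(iu) + U_(iy))%MM.
have wM : (wt (m + U_(iu) + U_(iy))%MM < d.+1)%N.
  by move: md; rewrite /wt !mnmDE !mnm1E /=; lia.
rewrite mpscoefMXXD ruz // svx // !subr0 => <-.
rewrite mpscoefMXX; case: ifP => // _; apply: r00.
by move: md; rewrite /wt !mnmBE !mnmDE !mnm1E /=; lia.
Qed.

End RegularPair.

Section RegularPowers.
Variables (A : comNzRingType) (b c : A).
Hypothesis c_reg : forall r s, r * c = s * c -> r = s.
Hypothesis b_nzd : forall r s, r * b = s * c -> exists t, r = t * c.

Lemma c_nzd r s : r * c = s * b -> exists t, r = t * b.
Proof.
move=> rs; have [t st] := b_nzd (esym rs); exists t; apply: c_reg.
by rewrite rs st; ring.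
Qed.

Lemma nzd_powers m k r s : r * b ^+ m = s * c ^+ k -> exists t, r = t * c ^+ k.
Proof.
have step k' r' s' : r' * b = s' * c ^+ k' -> exists t, r' = t * c ^+ k'.
  elim: k' r' s' => [|k' IH] r' s' rs; first by exists r'; rewrite expr0 mulr1.
  have /b_nzd[t tE] : r' * b = (s' * c ^+ k') * c by rewrite rs exprS; ring.
  have /IH[t' t'E] : t * b = s' * c ^+ k'.
    apply: c_reg; transitivity (r' * b); first by rewrite tE; ring.
    by rewrite rs exprS; ring.
  by exists t'; rewrite tE t'E exprS; ring.
elim: m r s => [|m IH] r s rs.
  by exists s; rewrite -rs expr0 mulr1.
have /IH[t] : (r * b) * b ^+ m = s * c ^+ k by rewrite -rs exprS; ring.
exact: step.
Qed.

(** For a regular sequence b, c, the colon ideal of (b^q, c^q) by (b, c) is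
generated by b^q, c^q and (b c)^(q - 1). *)
Lemma colon_regular_powers m r s t s' t' :
  r * b = s * b ^+ m.+1 + t * c ^+ m.+1 ->
  r * c = s' * b ^+ m.+1 + t' * c ^+ m.+1 ->
  exists k l h, r = k * b ^+ m.+1 + l * c ^+ m.+1 + h * (b * c) ^+ m.
Proof.
move=> rb rc.
have /(nzd_powers (m := 1))[l lE] : (r - s * b ^+ m) * b ^+ 1 = t * c ^+ m.+1.
  by rewrite expr1 mulrBl rb exprS; ring.
have rE : r = s * b ^+ m + l * c ^+ m.+1 by rewrite -lE; ring.
have /nzd_powers[h hE] : (s * c - s' * b) * b ^+ m = (t' - l * c) * c ^+ m.+1.
  transitivity (r * c - l * c * c ^+ m.+1 - s' * b ^+ m.+1).
    by rewrite rE [b ^+ m.+1]exprS; ring.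
  by rewrite rc; ring.
have /c_nzd[k kE] : (s - h * c ^+ m) * c = s' * b.
  transitivity (s * c - h * c ^+ m.+1); first by rewrite exprS; ring.
  by rewrite -hE; ring.
exists k, l, h.
have sE : s = k * b + h * c ^+ m by rewrite -kE; ring.
by rewrite rE sE exprMn [b ^+ m.+1]exprS; ring.
Qed.
End RegularPowers.

(** * Ideals with finitely many generators *)

Section Ideal3.
Variable A : comNzRingType.
Implicit Types f g h : A.

Definition gen2 a b f := exists r s, f = r * a + s * b.

Definition gen3 a b c f := exists r s t, f = r * a + s * b + t * c.

Variables a b c : A.

Lemma gen3D f g : gen3 a b c f -> gen3 a b c g -> gen3 a b c (f + g).
Proof.
move=> [r [s [t ->]]] [r' [s' [t' ->]]].
by exists (r + r'), (s + s'), (t + t'); ring.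
Qed.

Lemma gen3Ml f g : gen3 a b c g -> gen3 a b c (f * g).
Proof.
by move=> [r [s [t ->]]]; exists (f * r), (f * s), (f * t); ring.
Qed.

Lemma gen3Mr f g : gen3 a b c f -> gen3 a b c (f * g).
Proof. by rewrite mulrC; apply: gen3Ml. Qed.

Lemma gen3N f : gen3 a b c f -> gen3 a b c (- f).
Proof. by rewrite -mulN1r; apply: gen3Ml. Qed.

Lemma gen3B f g : gen3 a b c f -> gen3 a b c g -> gen3 a b c (f - g).
Proof. by move=> fI gI; apply/gen3D/gen3N. Qed.

Lemma gen3_1 : gen3 a b c a.
Proof. by exists 1, 0, 0; ring. Qed.
Lemma gen3_2 : gen3 a b c b.
Proof. by exists 0, 1, 0; ring. Qed.
Lemma gen3_3 : gen3 a b c c.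
Proof. by exists 0, 0, 1; ring. Qed.
End Ideal3.

Section IdealGen.
Local Open Scope classical_set_scope.
Variable A : comNzRingType.
Implicit Types (S : set A) (f g h : A) (P : A -> Prop).

Lemma ideal_gen_sub S P : P 0 -> (forall g h, P g -> P h -> P (g + h)) ->
  (forall g h, P h -> P (g * h)) -> (forall g, S g -> P g) ->
  forall f, ideal_gen S f -> P f.
Proof.
move=> P0 PD PM SP _ [k [r [g [gS ->]]]].
by elim/big_ind: _ => // i _; apply/PM/SP/gS.
Qed.

Lemma ideal_genD S g h : ideal_gen S g -> ideal_gen S h -> ideal_gen S (g + h).
Proof.
move=> [k [r [g' [gS ->]]]] [l [s [h' [hS ->]]]].
exists (k + l)%N.
exists (fun i => match split i with inl j => r j | inr j => s j end).
exists (fun i => match split i with inl j => g' j | inr j => h' j end).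
split=> [i|]; first by case: (split i).
rewrite big_split_ord; congr (_ + _); apply: eq_bigr => i _.
  by have := unsplitK (inl i : 'I_k + 'I_l); rewrite /= => ->.
by have := unsplitK (inr i : 'I_k + 'I_l); rewrite /= => ->.
Qed.

Lemma ideal_genMl S g h : ideal_gen S h -> ideal_gen S (g * h).
Proof.
move=> [k [r [h' [hS ->]]]]; exists k, (fun i => g * r i), h'; split=> //.
by rewrite mulr_sumr; apply: eq_bigr => i _; rewrite mulrA.
Qed.

Lemma mem_ideal_gen S g : S g -> ideal_gen S g.
Proof.
by move=> Sg; exists 1, (fun=> 1), (fun=> g); split=> //;
  rewrite big_ord1 mul1r.
Qed.

Lemma ideal_gen1 g f : ideal_gen [set g] f <-> exists h, f = h * g.
Proof.
split=> [|[h ->]]; last exact/ideal_genMl/mem_ideal_gen.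
move: f; apply: (@ideal_gen_sub _ (fun f => exists h, f = h * g))
    => [|f1 f2 [h1 ->] [h2 ->]|f1 f2 [h ->]|_ ->].
- by exists 0; rewrite mul0r.
- by exists (h1 + h2); rewrite mulrDl.
- by exists (f1 * h); rewrite mulrA.
- by exists 1; rewrite mul1r.
Qed.

Lemma gen3_0 (a b c : A) : gen3 a b c 0.
Proof. by exists 0, 0, 0; rewrite !mul0r !addr0. Qed.

Lemma ideal_gen3 (a b c : A) : ideal_gen [set a; b; c] = gen3 a b c.
Proof.
apply/seteqP; split.
  apply: ideal_gen_sub => [|g h|g h|_ [[|]|] ->].
  - exact: gen3_0.
  - exact: gen3D.
  - exact: gen3Ml.
  - exact: gen3_1.
  - exact: gen3_2.
  - exact: gen3_3.
move=> _ [r [s [t ->]]].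
by do 2?apply: ideal_genD; apply/ideal_genMl/mem_ideal_gen;
  [left; left|left; right|right].
Qed.

(** A power of the characteristic commutes with sums, so that the Frobenius
power is generated by the powers of the three generators alone. *)
Lemma frobenius_power3 q (a b c : A) : [pchar A].-nat q ->
  frobenius_power q (ideal_gen [set a; b; c]) = gen3 (a ^+ q) (b ^+ q) (c ^+ q).
Proof.
move=> qA; rewrite ideal_gen3; apply/seteqP; split.
  apply: ideal_gen_sub => [|g h|g h|_ [_ [r [s [t ->]]] <-]].
  - exact: gen3_0.
  - exact: gen3D.
  - exact: gen3Ml.
  by rewrite !exprDn_pchar // !exprMn; exists (r ^+ q), (s ^+ q), (t ^+ q).
move=> _ [r [s [t ->]]].
do 2?apply: ideal_genD; apply/ideal_genMl/mem_ideal_gen.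
- by exists a => //; apply: gen3_1.
- by exists b => //; apply: gen3_2.
- by exists c => //; apply: gen3_3.
Qed.
End IdealGen.

(** * Regular elements modulo the minors and modulo variables *)

Section MinorsNzd.
Variables (A : comNzRingType) (U V W X Y Z : A).

Hypothesis minor_nzd : forall r s t,
  r * (V * Z - W * Y) = s * X + t * U -> exists s' t', r = s' * X + t' * U.
Hypothesis U_nzd : forall r s, r * U = s * X -> exists s', r = s' * X.
Hypothesis Y_nzd : forall r s, r * Y = s * X -> exists s', r = s' * X.
Hypothesis Z_nzd : forall r s t,
  r * Z = s * X + t * Y -> exists s' t', r = s' * X + t' * Y.
Hypothesis X_reg : forall r s, r * X = s * X -> r = s.

(** The relation f X = r a + s b + t c is first read modulo (X, U), then modulo
(X, Y) and X: each reading makes one coefficient more explicit, until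
(r, s, t) is, up to multiples of X, a combination r0 (U, V, W) - d (X, Y, Z) of
the two rows of the matrix, which are relations between the minors.  The rows
contribute zero to f X, so that X divides what remains and can be cancelled. *)
Lemma minors_nzd f r s t :
  f * X = r * (V * Z - W * Y) + s * (W * X - U * Z) + t * (U * Y - V * X) ->
  exists r' s' t',
    f = r' * (V * Z - W * Y) + s' * (W * X - U * Z) + t' * (U * Y - V * X).
Proof.
move=> fE.
have /minor_nzd[r1 [r0 rE]] :
    r * (V * Z - W * Y) = (f - s * W + t * V) * X + (s * Z - t * Y) * U.
  transitivity (f * X - s * (W * X - U * Z) - t * (U * Y - V * X));
    last by ring.
  by rewrite fE; ring.
have /U_nzd[k kE] : (r0 * (V * Z - W * Y) - s * Z + t * Y) * U =
    (f - s * W + t * V - r1 * (V * Z - W * Y)) * X.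
  transitivity (r * (V * Z - W * Y) - r1 * X * (V * Z - W * Y)
    - (s * Z - t * Y) * U).
    by rewrite rE; ring.
  transitivity (f * X - s * (W * X - U * Z) - t * (U * Y - V * X)
     - r1 * X * (V * Z - W * Y) - (s * Z - t * Y) * U); last by ring.
  by rewrite fE; ring.
have /Z_nzd[s1 [d sE]] : (r0 * V - s) * Z = k * X + (r0 * W - t) * Y.
  by rewrite -kE; ring.
have sE' : s = r0 * V - s1 * X - d * Y by rewrite -addrA -opprD -sE; ring.
have /Y_nzd[t1 tE] : (t - r0 * W + d * Z) * Y = (k - s1 * Z) * X.
  by rewrite mulrBl -kE sE'; ring.
have tE' : t = r0 * W - d * Z + t1 * X by rewrite -tE; ring.
exists (r1 + d), (- s1), t1; apply: X_reg.
by rewrite fE rE sE' tE'; ring.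
Qed.
End MinorsNzd.

Lemma exprBn_pchar (A : comNzRingType) (f g : A) q :
  [pchar A].-nat q -> (f - g) ^+ q = f ^+ q - g ^+ q.
Proof. by move=> qA; rewrite exprDn_pchar // exprNn_pchar. Qed.

Lemma expr_minor_pchar (A : comNzRingType) (f g h k : A) q :
  [pchar A].-nat q ->
  (f * g - h * k) ^+ q = f ^+ q * g ^+ q - h ^+ q * k ^+ q.
Proof. by move=> qA; rewrite exprBn_pchar // !exprMn. Qed.

(** Exchanging the rows of the matrix changes the signs of the minors; thereby
what holds for x modulo the minors holds for u. *)
Lemma gen3_swap_rows (A : comNzRingType) (u v w x y z : A) q f :
  [pchar A].-nat q ->
  gen3 ((v * z - w * y) ^+ q) ((w * x - u * z) ^+ q) ((u * y - v * x) ^+ q) f ->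
  gen3 ((y * w - z * v) ^+ q) ((z * u - x * w) ^+ q) ((x * v - y * u) ^+ q) f.
Proof.
move=> qA; have -> : y * w - z * v = - (v * z - w * y) by ring.
have -> : z * u - x * w = - (w * x - u * z) by ring.
have -> : x * v - y * u = - (u * y - v * x) by ring.
rewrite !exprNn_pchar // => -[r [s [t ->]]].
by exists (- r), (- s), (- t); ring.
Qed.

Lemma variable_nzd_minors (k : nat) (R : comNzRingType) (u v w x y z : 'I_k) q
  (f : mpseries k R) :
  let X := mpsX R in
  let a := X v * X z - X w * X y in
  let b := X w * X x - X u * X z in
  let c := X u * X y - X v * X x in
  [pchar (mpseries k R)].-nat q ->
  [&& v \notin [:: x; u], z \notin [:: x; u], w \notin [:: v; z; y],
      u != x, y != x & z \notin [:: x; y]] ->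
  gen3 (a ^+ q) (b ^+ q) (c ^+ q) (f * X x) ->
  gen3 (a ^+ q) (b ^+ q) (c ^+ q) f.
Proof.
move=> X a b c qA /and5P[vxu zxu wvzy ux /andP[yx zxy]].
have aE : a ^+ q = X v ^+ q * X z ^+ q - X w ^+ q * X y ^+ q.
  exact: expr_minor_pchar.
have bE : b ^+ q = X w ^+ q * X x ^+ q - X u ^+ q * X z ^+ q.
  exact: expr_minor_pchar.
have cE : c ^+ q = X u ^+ q * X y ^+ q - X v ^+ q * X x ^+ q.
  exact: expr_minor_pchar.
have q_gt0 : (0 < q)%N by case/andP: qA.
move=> /gen3Mr-/(_ (X x ^+ q.-1)); rewrite -mulrA -exprS prednK //.
move=> [r [s [t]]]; rewrite /gen3 bE cE [in f * _ = _]aE [in exists _, _]aE.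
(* The generators are the minors of the matrix of q-th powers. *)
apply: minors_nzd => {r s t}.
- move=> r s t rst; apply/above_supported2.
  apply: (above_binomial_nzd (i := v) (j := z) (k := w) (l := y) (e := q)) => //.
  by apply/above_supported2; exists s, t; rewrite -[LHS]/(r * a ^+ q) aE.
- move=> r s rs; apply/above_supported1.
  apply: (above_variable_nzd (i := u) (k := q)); first by rewrite inE.
  by apply/above_supported1; exists s.
- move=> r s rs; apply/above_supported1.
  apply: (above_variable_nzd (i := y) (k := q)); first by rewrite inE.
  by apply/above_supported1; exists s.
- move=> r s t rs; apply/above_supported2.
  apply: (above_variable_nzd (i := z) (k := q)) => //.
  by apply/above_supported2; exists s, t.
- by move=> r s; apply: mpsXn_inj.
Qed.

Section SeriesFacts.
Variables (n : nat) (R : comNzRingType).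
Implicit Types (f g h : mpseries n R) (i j k l : 'I_n).
Local Notation X := (mpsX R).

Lemma above_supported3 i (d : nat) j e k (r : nat) f :
  supported (above [:: (i, d); (j, e); (k, r)]) f <->
  gen3 (X i ^+ d) (X j ^+ e) (X k ^+ r) f.
Proof.
split=> [/above_supported_cons[g [h [-> /above_supported2[h1 [h2 ->]]]]]|].
  by exists g, h1, h2; rewrite addrA.
move=> [g [h1 [h2 ->]]]; apply/above_supported_cons.
exists g, (h1 * X j ^+ e + h2 * X k ^+ r); split; first by rewrite addrA.
by apply/above_supported2; exists h1, h2.
Qed.

Lemma binomial_reg i j k l f g : k \notin [:: i; j; l] ->
  f * (X i * X j - X k * X l) = g * (X i * X j - X k * X l) -> f = g.
Proof.
move=> kijl fg; apply/subr0_eq/supported0.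
apply: (@above_binomial_nzd _ _ [::] i j k l 1) => //.
by rewrite expr1 mulrBl fg subrr.
Qed.

Lemma binomial_nzd_gen2 x u i j k l (d e : nat) f :
  i \notin [:: x; u] -> j \notin [:: x; u] -> k \notin [:: i; j; l] ->
  gen2 (X x) (X u ^+ d) (f * (X i * X j - X k * X l) ^+ e) ->
  gen2 (X x) (X u ^+ d) f.
Proof.
move=> ixu jxu kijl; rewrite -[X x]expr1 => /above_supported2 fs.
by apply/above_supported2; apply: above_binomial_nzd fs.
Qed.

Lemma power_shift_gen2 x u d f : u != x ->
  gen2 (X x) (X u ^+ d.+1) (f * X u ^+ d) -> gen2 (X x) (X u) f.
Proof.
move=> ux; rewrite -[X x]expr1 => /above_supported2 fs.
suff : gen2 (X x ^+ 1) (X u ^+ 1) f by rewrite (expr1 (X u)).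
apply/above_supported2.
apply: supportedMXnK fs => m; rewrite /above /= !mnmDE !mulmnE !mnm1E eqxx.
by rewrite (negPf ux) mul0n mul1n addn0 -[d.+1]add1n leq_add2r.
Qed.

Lemma variable_nzd_gen2 x u i f : i \notin [:: x; u] ->
  gen2 (X x) (X u) (f * X i) -> gen2 (X x) (X u) f.
Proof.
move=> ixu; rewrite -[X x]expr1 -[X u]expr1 -[X i]expr1.
by move=> /above_supported2 fs; apply/above_supported2;
  apply: above_variable_nzd fs.
Qed.

Lemma variable_nzd_gen3 x u y i f : i \notin [:: x; u; y] ->
  gen3 (X x) (X u) (X y) (f * X i) -> gen3 (X x) (X u) (X y) f.
Proof.
move=> ixu; rewrite -[X x]expr1 -[X u]expr1 -[X y]expr1 -[X i]expr1.
by move=> /above_supported3 fs; apply/above_supported3;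
  apply: above_variable_nzd fs.
Qed.

End SeriesFacts.

(** * Truncation by degree in some of the variables *)

Section Gradation.
Variables (A : comNzRingType) (T : nat -> A -> A).
Hypothesis TD : forall d f g, T d (f + g) = T d f + T d g.
Hypothesis TB : forall d f g, T d (f - g) = T d f - T d g.

(** When T d keeps the terms of degree at least d, this says that e is
homogeneous of degree k.  The truncated subtraction is meant: for d <= k,
T 0 is the identity. *)
Definition graded k e := forall d f, T d (f * e) = T (d - k) f * e.

Lemma gradedM k k' e e' :
  graded k e -> graded k' e' -> graded (k + k') (e * e').
Proof. by move=> eH eH' d f; rewrite mulrA eH' eH mulrA addnC subnDA. Qed.

Lemma gradedB k e e' : graded k e -> graded k e' -> graded k (e - e').
Proof. by move=> eH eH' d f; rewrite !mulrBr TB eH eH'. Qed.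

Lemma gradedXn k e r : graded k e -> graded (k * r) (e ^+ r).
Proof.
move=> eH; elim: r => [|r IH]; last by rewrite exprS mulnS; apply: gradedM.
by move=> d f; rewrite expr0 muln0 !mulr1 subn0.
Qed.

Lemma graded_gen3 k a b c d f : graded k a -> graded k b -> graded k c ->
  gen3 a b c f -> gen3 a b c (T d f).
Proof.
move=> aH bH cH [r [s [t ->]]]; rewrite !TD aH bH cH.
by exists (T (d - k) r), (T (d - k) s), (T (d - k) t).
Qed.
End Gradation.

Section Truncation.
Variables (n : nat) (R : comNzRingType).
Implicit Types (f g h : mpseries n R).
Local Notation X := (mpsX R).

Section Weight.
Variable wt : 'X_{1..n} -> nat.
Hypothesis wtD : forall m m', wt (m + m')%MM = (wt m + wt m')%N.

Definition trunc d f : mpseries n R :=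
  MPSeries (fun m => if (d <= wt m)%N then mpscoef f m else 0).

Lemma mpscoef_trunc d f m :
  mpscoef (trunc d f) m = if (d <= wt m)%N then mpscoef f m else 0.
Proof. by []. Qed.

Lemma truncD d f g : trunc d (f + g) = trunc d f + trunc d g.
Proof. by apply/mpsP => m /=; case: ifP => // _; rewrite addr0. Qed.

Lemma truncB d f g : trunc d (f - g) = trunc d f - trunc d g.
Proof.
rewrite truncD; congr (_ + _).
by apply/mpsP => m /=; case: ifP => // _; rewrite oppr0.
Qed.

Lemma trunc0 f : trunc 0 f = f.
Proof. by apply/mpsP. Qed.

Lemma supported_trunc d f : supported (fun m => d <= wt m)%N (trunc d f).
Proof. by move=> m /negPf /= ->. Qed.

Lemma graded_var i : graded trunc (wt U_(i)%MM) (X i).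
Proof.
move=> d f; apply/mpsP => m; rewrite mpscoef_trunc !mpscoefMX.
case: (posnP (m i)) => [_|mi]; first by rewrite if_same.
rewrite mpscoef_trunc leq_subLR -wtD addmC submK //.
by apply/mnm_lepP => j; rewrite mnm1E; case: eqP => [<-|].
Qed.

End Weight.

Definition deg3 (i j k : 'I_n) (m : 'X_{1..n}) := (m i + m j + m k)%N.

Lemma deg3D i j k m m' :
  deg3 i j k (m + m')%MM = (deg3 i j k m + deg3 i j k m')%N.
Proof. by rewrite /deg3 !mnmDE; lia. Qed.

(** A series of order at least d lies in the ideal generated by the monomials of
degree d.  That ideal appears through an arbitrary J that is closed under sums
and multiples and contains these monomials, which makes the induction on d go
through with the ideal of the g such that g X_l is in J. *)
Lemma order_monomials i j k (uijk : uniq [:: i; j; k]) d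
    (J : mpseries n R -> Prop) f :
  (forall g h, J g -> J h -> J (g + h)) -> (forall g h, J h -> J (g * h)) ->
  (forall r s t, (r + s + t = d)%N -> J (X i ^+ r * X j ^+ s * X k ^+ t)) ->
  supported (fun m => d <= deg3 i j k m)%N f -> J f.
Proof.
elim: d J f => [|d IH] J f JD JM Jmon fd.
  by have := JM f _ (Jmon 0 0 0 erefl); rewrite !expr0 !mulr1.
have step l (lE : l \in [:: i; j; k]) (g : mpseries n R) :
    supported (fun m => d <= deg3 i j k m)%N g -> J (g * X l).
  move=> gd; apply: (IH (fun g => J (g * X l)) g _ _ _ gd).
  - by move=> g1 g2; rewrite mulrDl; apply: JD.
  - by move=> g1 g2; rewrite -mulrA; apply: JM.
  move=> r s t rst; move: lE; rewrite !inE => /or3P[] /eqP ->.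
  - have := Jmon r.+1 s t; rewrite !addSn rst => /(_ erefl).
    by congr J; rewrite exprS; ring.
  - have := Jmon r s.+1 t; rewrite !(addnS, addSn) rst => /(_ erefl).
    by congr J; rewrite exprS; ring.
  - have := Jmon r s t.+1; rewrite !addnS rst => /(_ erefl).
    by congr J; rewrite exprS; ring.
have shift l (lE : l \in [:: i; j; k]) m :
    (d < deg3 i j k (m + U_(l) *+ 1))%N -> (d <= deg3 i j k m)%N.
  move: uijk lE; rewrite /= !inE !negb_or mulm1n deg3D {2}/deg3 !mnm1E.
  move=> /and3P[/andP[/negPf ij /negPf ik] /negPf jk _].
  by move=> /or3P[] /eqP ->; rewrite ?eqxx ?[j == i]eq_sym
    ?[k == i]eq_sym ?[k == j]eq_sym ?ij ?ik ?jk; lia.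
pose P1 m := (d < deg3 i j k m)%N && (m i == 0)%N.
pose P2 m := P1 m && (m j == 0)%N.
have [g1 [h1 [-> g1d h1P]]] : exists g h, [/\ f = g * X i ^+ 1 + h,
    supported (fun m => d < deg3 i j k (m + U_(i) *+ 1))%N g & supported P1 h].
  by apply: (supported_split _ fd) => m md; rewrite /P1 md /= lt0n orNb.
have [g2 [h2 [-> g2d h2P]]] : exists g h, [/\ h1 = g * X j ^+ 1 + h,
    supported (fun m => P1 (m + U_(j) *+ 1)%MM) g & supported P2 h].
  by apply: (supported_split _ h1P) => m md; rewrite /P2 md /= lt0n orNb.
have [g3 [h3 [-> g3d /supported0->]]] : exists g h, [/\ h2 = g * X k ^+ 1 + h,
    supported (fun m => P2 (m + U_(k) *+ 1)%MM) g & supported pred0 h].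
  apply: (supported_split _ h2P) => m;
    rewrite orbF => /andP[/andP[+ /eqP m1] /eqP m2].
  by rewrite /deg3 m1 m2; lia.
rewrite addr0 !expr1; apply: (JD); [|apply: (JD)]; apply: step;
  rewrite ?inE ?eqxx ?orbT //.
- by apply: supported_sub g1d => m; apply: shift; rewrite !inE eqxx.
- by apply: supported_sub g2d => m /andP[+ _]; apply: shift;
  rewrite !inE eqxx orbT.
- apply: supported_sub g3d => m /andP[/andP[+ _] _].
  by apply: shift; rewrite !inE eqxx !orbT.
Qed.

End Truncation.

(** * The colon ideal of the minors *)

(** The colon ideal is computed in an arbitrary commutative ring with six
elements that have the regularity properties consumed by the argument, and with
maps T d that behave like the truncations to degree at least d in x, y, z. *)
Section Determinantal.
Variables (A : comNzRingType) (u v w x y z : A) (n : nat).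
Notation a := (v * z - w * y).
Notation b := (w * x - u * z).
Notation c := (u * y - v * x).
Notation Iq := (gen3 (a ^+ n.+1) (b ^+ n.+1) (c ^+ n.+1)).
Implicit Types f g h : A.

Hypothesis qA : [pchar A].-nat n.+1.
Hypothesis x_nzd : forall f, Iq (f * x) -> Iq f.
Hypothesis u_nzd : forall f, Iq (f * u) -> Iq f.

Lemma xn_nzd k f : Iq (f * x ^+ k) -> Iq f.
Proof.
elim: k f => [|k IH] f; first by rewrite expr0 mulr1.
by rewrite [x ^+ _]exprS mulrA => /IH; apply: x_nzd.
Qed.

Lemma un_nzd k f : Iq (f * u ^+ k) -> Iq f.
Proof.
elim: k f => [|k IH] f; first by rewrite expr0 mulr1.
by rewrite [u ^+ _]exprS mulrA => /IH; apply: u_nzd.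
Qed.

(** x (bc)^n a = - (y c^n) b^q - (z b^n) c^q, and x is regular modulo Iq. *)
Lemma a_colon : Iq ((b * c) ^+ n * a).
Proof.
apply: x_nzd.
have -> : (b * c) ^+ n * a * x =
  (- y * c ^+ n) * b ^+ n.+1 + (- z * b ^+ n) * c ^+ n.+1.
  by rewrite !exprS exprMn; ring.
exact/gen3D/gen3Ml/gen3_3/gen3Ml/gen3_2.
Qed.

Lemma bc_colon f : gen3 a b c f -> Iq ((b * c) ^+ n * f).
Proof.
move=> [r [s [t ->]]].
have -> : (b * c) ^+ n * (r * a + s * b + t * c) =
  r * ((b * c) ^+ n * a) + (s * c ^+ n) * b ^+ n.+1 + (t * b ^+ n) * c ^+ n.+1.
  by rewrite !exprS exprMn; ring.
apply: gen3D; last exact/gen3Ml/gen3_3.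
by apply: gen3D; [exact/gen3Ml/a_colon|exact/gen3Ml/gen3_2].
Qed.

Lemma quotient_unique k g f f' :
  Iq (g - x ^+ k * f) -> Iq (g - x ^+ k * f') -> Iq (f - f').
Proof.
move=> gf gf'; apply: (@xn_nzd k).
by have := gen3B gf' gf; congr (Iq _); ring.
Qed.

Lemma quotient_colon s t f h : gen3 a b c h ->
  Iq (y ^+ s * z ^+ t * (b * c) ^+ n - x ^+ (s + t) * f) -> Iq (f * h).
Proof.
move=> /bc_colon hI fI; apply: (@xn_nzd (s + t)).
have := gen3B (gen3Ml (y ^+ s * z ^+ t) hI) (gen3Ml h fI).
by congr (Iq _); ring.
Qed.

(** Modulo Iq, u^q y^q and u^q z^q are multiples of x^q.  In the binomial
expansion of the product, a term with fewer than s + t factors x has at least q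
factors u, and moreover at least q factors y or q factors z. *)
Lemma x_divides s t : (s + t <= n)%N -> exists i g, Iq i /\
  y ^+ s * z ^+ t * (b * c) ^+ n = i + g * x ^+ (s + t).
Proof.
move=> stn; pose J f := exists i g, Iq i /\ f = i + g * x ^+ (s + t).
have JD f g : J f -> J g -> J (f + g).
  move=> [i [k [iI ->]]] [i' [k' [iI' ->]]].
  by exists (i + i'), (k + k'); split; [exact: gen3D|ring].
have JM f g : J g -> J (f * g).
  move=> [i [k [iI ->]]]; exists (f * i), (f * k).
  by split; [exact: gen3Ml|ring].
have J0 : J 0 by exists 0, 0; split; [exists 0, 0, 0; ring|ring].
have Jx k : (s + t <= k)%N -> J (x ^+ k).
  move=> stk; exists 0, (x ^+ (k - (s + t))); split.
    by exists 0, 0, 0; ring.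
  by rewrite add0r -exprD subnK.
have JI i : Iq i -> J i.
  by move=> iI; exists i, 0; split=> //; ring.
have stn1 : (s + t <= n.+1)%N by lia.
have Juy : J (u ^+ n.+1 * y ^+ n.+1).
  have -> : u ^+ n.+1 * y ^+ n.+1 = c ^+ n.+1 + v ^+ n.+1 * x ^+ n.+1.
    by rewrite exprBn_pchar // !exprMn; ring.
  by apply: JD; [exact/JI/gen3_3|exact/JM/Jx].
have Juz : J (u ^+ n.+1 * z ^+ n.+1).
  have -> : u ^+ n.+1 * z ^+ n.+1 = - b ^+ n.+1 + w ^+ n.+1 * x ^+ n.+1.
    by rewrite exprBn_pchar // !exprMn; ring.
  by apply: JD; [exact/JI/gen3N/gen3_2|exact/JM/Jx].
have Jsum k (E : 'I_k -> A) : (forall i, J (E i)) -> J (\sum_(i < k) E i).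
  by move=> JE; elim/big_ind: _.
suff : J (y ^+ s * z ^+ t * (b * c) ^+ n) by [].
rewrite exprMn !exprDn big_distrlr /= mulr_sumr.
apply: (Jsum) => i; rewrite mulr_sumr; apply: Jsum => j.
rewrite -[_ *+ 'C(n, i)]mulr_natl -[_ *+ 'C(n, j)]mulr_natl.
set C := _%:R; set C' := _%:R; set k := (n - i)%N; set l := (n - j)%N.
have kE : (k + i = n)%N by rewrite subnK // -ltnS.
have lE : (l + j = n)%N by rewrite subnK // -ltnS.
have -> : y ^+ s * z ^+ t * (C * ((w * x) ^+ k * (- (u * z)) ^+ i) *
    (C' * ((u * y) ^+ l * (- (v * x)) ^+ j))) =
  (C * C' * w ^+ k * v ^+ j * (-1) ^+ i * (-1) ^+ j) *
  (u ^+ (i + l) * y ^+ (s + l) * z ^+ (t + i) * x ^+ (k + j)).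
  by rewrite -[- (u * z)]mulN1r -[- (v * x)]mulN1r !exprMn !exprD; ring.
(* k + j is the number of factors x of the term. *)
apply: (JM); have [stkj|kjst] := leqP (s + t) (k + j); first exact/JM/Jx.
have uq : (n.+1 <= i + l)%N by lia.
have [sl|sl] := leqP n.+1 (s + l).
  rewrite -(subnKC uq) -(subnKC sl) !exprD.
  set r := u ^+ (_ - _); set r' := y ^+ (_ - _).
  rewrite (_ : _ * _ = (r * r' * z ^+ t * z ^+ i * x ^+ k * x ^+ j) *
    (u ^+ n.+1 * y ^+ n.+1)); first exact: JM.
  by ring.
have ti : (n.+1 <= t + i)%N by lia.
rewrite -(subnKC uq) -(subnKC ti) !exprD.
set r := u ^+ (_ - _); set r' := z ^+ (_ - _).
rewrite (_ : _ * _ = (r * r' * y ^+ s * y ^+ l * x ^+ k * x ^+ j) *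
    (u ^+ n.+1 * z ^+ n.+1)); first exact: JM.
by ring.
Qed.

Hypothesis a_nzd :
  forall j k f, gen2 x (u ^+ j) (f * a ^+ k) -> gen2 x (u ^+ j) f.
Hypothesis un_shift : forall k f, gen2 x (u ^+ k.+1) (f * u ^+ k) -> gen2 x u f.
Hypothesis y_nzd : forall f, gen2 x u (f * y) -> gen2 x u f.
Hypothesis vz_nzd : forall f, gen3 x u y (f * (v * z)) -> gen3 x u y f.

(** Modulo (x, u), f y = t a says t v z = (f + t w) y.  As vz is regular modulo
(x, u, y), y divides t and can be cancelled. *)
Lemma y_nzd_minor f : gen3 x u a (f * y) -> gen3 x u a f.
Proof.
move=> [r [s [t ft]]].
have /vz_nzd[t1 [t2 [t3 tE]]] : gen3 x u y (t * (v * z)).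
  exists (- r), (- s), (f + t * w); rewrite [(f + _) * y]mulrDl ft; ring.
have /y_nzd[k [l kl]] : gen2 x u ((f - t3 * a) * y).
  by exists (r + t1 * a), (s + t2 * a); rewrite mulrBl ft tE; ring.
by exists k, l, t3; rewrite -kl subrK.
Qed.

Lemma yn_nzd_minor k f : gen3 x u a (f * y ^+ k) -> gen3 x u a f.
Proof.
elim: k f => [|k IH] f; first by rewrite expr0 mulr1.
by rewrite exprS mulrA => /IH; apply: y_nzd_minor.
Qed.

Lemma exprD_mod (p r s : A) k : exists t, (p + r * s) ^+ k = p ^+ k + t * s.
Proof.
have := subrXX (p + r * s) p k; rewrite [p + _ - p]addrAC subrr add0r.
set S := \sum_(_ < _) _ => E; exists (r * S).
by rewrite -[LHS](subrK (p ^+ k)) E; ring.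
Qed.

(** The congruence (yb)^n c^n = (-xa)^n c^n modulo c^q turns the hypothesis,
after multiplication by y^n and cancellation of x^n, into: h (ac)^n lies in
Iq + (x) up to sign.  Modulo x, b = - uz and c = uy, so that
h a^n (uy)^n - r a^q lies in (x, u^q); dividing by u^n and then by a^n gives
y^n h in (x, u, a), where y is regular. *)
Lemma numerator_in_xua h i g : Iq i ->
  h * (b * c) ^+ n = i + g * x ^+ n.+1 -> gen3 x u a h.
Proof.
move=> iI hE.
have [S ybE] := exprD_mod (- (x * a)) (- z) c n.
have {}ybE : (y * b) ^+ n = (-1) ^+ n * (x * a) ^+ n + S * c.
  by rewrite -exprMn mulN1r -ybE; congr (_ ^+ n); ring.
have [r [s [t rst]]] : Iq (h * (-1) ^+ n * (a * c) ^+ n - g * y ^+ n * x).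
  apply: (@xn_nzd n).
  have -> : (h * (-1) ^+ n * (a * c) ^+ n - g * y ^+ n * x) * x ^+ n =
      y ^+ n * i - (h * S) * c ^+ n.+1.
    have iE : i = h * (b * c) ^+ n - g * x ^+ n.+1 by rewrite hE addrK.
    have yi : y ^+ n * i =
      h * (y * b) ^+ n * c ^+ n - g * y ^+ n * x ^+ n.+1.
      by rewrite iE !exprMn; ring.
    by rewrite yi ybE !exprMn !exprS; ring.
  by apply: gen3B; [exact: gen3Ml|exact/gen3Ml/gen3_3].
have [S1 bE] := exprD_mod (- (u * z)) w x n.+1.
have [S2 cE] := exprD_mod (u * y) (- v) x n.+1.
have [S3 cnE] := exprD_mod (u * y) (- v) x n.
have {}bE : b ^+ n.+1 = (- z) ^+ n.+1 * u ^+ n.+1 + S1 * x.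
  rewrite (_ : b = - (u * z) + w * x); last by rewrite addrC.
  by rewrite bE; congr (_ + _); rewrite -exprMn; congr (_ ^+ _); ring.
have {}cE : c ^+ n.+1 = y ^+ n.+1 * u ^+ n.+1 + S2 * x.
  by rewrite -exprMn [y * u]mulrC -cE; congr (_ ^+ _); ring.
have {}cnE : c ^+ n = y ^+ n * u ^+ n + S3 * x.
  by rewrite -exprMn [y * u]mulrC -cnE; congr (_ ^+ _); ring.
set h' := h * (-1) ^+ n in rst.
have {}rst : h' * a ^+ n * y ^+ n * u ^+ n - r * a ^+ n.+1 =
    (g * y ^+ n + s * S1 + t * S2 - h' * a ^+ n * S3) * x
      + (s * (- z) ^+ n.+1 + t * y ^+ n.+1) * u ^+ n.+1.
  transitivity (h' * (a * c) ^+ n - h' * a ^+ n * S3 * x - r * a ^+ n.+1).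
    by rewrite [(a * c) ^+ n]exprMn cnE; ring.
  transitivity (s * b ^+ n.+1 + t * c ^+ n.+1 +
    g * y ^+ n * x - h' * a ^+ n * S3 * x).
    by rewrite -[h' * _](subrK (g * y ^+ n * x)) rst; ring.
  by rewrite bE cE; ring.
set k1 := (X in X * x) in rst; set k2 := (X in X * u ^+ n.+1) in rst.
have /a_nzd[r1 [r2 rE]] : gen2 x (u ^+ n) (r * a ^+ n.+1).
  exists (- k1), (h' * a ^+ n * y ^+ n - k2 * u).
  rewrite -[LHS]opprK -[- (r * _)](addKr (h' * a ^+ n * y ^+ n * u ^+ n)).
  by rewrite rst [u ^+ n.+1]exprS; ring.
have /un_shift : gen2 x (u ^+ n.+1) ((h' * y ^+ n - r2 * a) * a ^+ n * u ^+ n).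
  exists (k1 + r1 * a ^+ n.+1), k2.
  transitivity (h' * a ^+ n * y ^+ n * u ^+ n - r * a ^+ n.+1 +
    r1 * a ^+ n.+1 * x).
    by rewrite rE [a ^+ n.+1]exprS; ring.
  by rewrite rst; ring.
rewrite -[u in gen2 x u]expr1 => /a_nzd[l1 [l2 l12]].
have /yn_nzd_minor[m1 [m2 [m3 hm]]] : gen3 x u a (h' * y ^+ n).
  by exists l1, l2, r2; rewrite -[LHS](subrK (r2 * a)) l12 expr1.
have -> : h = (-1) ^+ n * h'.
  by rewrite /h' mulrCA -exprMn mulrNN mulr1 expr1n mulr1.
by apply: gen3Ml; exists m1, m2, m3.
Qed.

Hypothesis c_reg : forall r s, r * c = s * c -> r = s.
Hypothesis b_nzd : forall r s, r * b = s * c -> exists t, r = t * c.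

(** If l a lies in (b, c), then l^q Iq is contained in (b^q, c^q), whose colon
by (b, c) is known.  This applies to the two entries l = x and l = u of the
first column. *)
Lemma colon_multiple l k m g : l * a = k * b + m * c ->
  Iq (g * b) -> Iq (g * c) ->
  exists i h, Iq i /\ g * l ^+ n.+1 = i + h * (b * c) ^+ n.
Proof.
move=> la gb gc.
have laq : l ^+ n.+1 * a ^+ n.+1 =
  k ^+ n.+1 * b ^+ n.+1 + m ^+ n.+1 * c ^+ n.+1.
  by rewrite -!exprMn la exprDn_pchar.
have in_bc f :
  Iq f -> exists s t, f * l ^+ n.+1 = s * b ^+ n.+1 + t * c ^+ n.+1.
  move=> [r [s [t ->]]].
  exists (r * k ^+ n.+1 + s * l ^+ n.+1), (r * m ^+ n.+1 + t * l ^+ n.+1).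
  transitivity (r * (l ^+ n.+1 * a ^+ n.+1) +
     (s * b ^+ n.+1 + t * c ^+ n.+1) * l ^+ n.+1); first by ring.
  by rewrite laq; ring.
have [s [t st]] := in_bc _ gb; have [s' [t' st']] := in_bc _ gc.
have [] := @colon_regular_powers A b c c_reg b_nzd n (g * l ^+ n.+1) s t s' t'.
- by rewrite mulrAC.
- by rewrite mulrAC.
move=> k1 [k2 [h hE]]; exists (k1 * b ^+ n.+1 + k2 * c ^+ n.+1), h; split=> //.
by apply: gen3D; [exact/gen3Ml/gen3_2|exact/gen3Ml/gen3_3].
Qed.

Variable T : nat -> A -> A.
Hypothesis T0 : forall f, T 0 f = f.
Hypothesis TD : forall d f g, T d (f + g) = T d f + T d g.
Hypothesis TB : forall d f g, T d (f - g) = T d f - T d g.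
Hypotheses (Tu : graded T 0 u) (Tv : graded T 0 v) (Tw : graded T 0 w).
Hypotheses (Tx : graded T 1 x) (Ty : graded T 1 y) (Tz : graded T 1 z).
Hypothesis T_monomials : forall d (J : A -> Prop) f,
  (forall g h, J g -> J h -> J (g + h)) -> (forall g h, J h -> J (g * h)) ->
  (forall i j k, (i + j + k = d)%N -> J (x ^+ i * y ^+ j * z ^+ k)) ->
    J (T d f).

Lemma graded_a : graded T 1 a.
Proof. by apply: (gradedB TB);
  [exact: (gradedM Tv Tz)|exact: (gradedM Tw Ty)]. Qed.
Lemma graded_b : graded T 1 b.
Proof. by apply: (gradedB TB);
  [exact: (gradedM Tw Tx)|exact: (gradedM Tu Tz)]. Qed.
Lemma graded_c : graded T 1 c.
Proof. by apply: (gradedB TB);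
  [exact: (gradedM Tu Ty)|exact: (gradedM Tv Tx)]. Qed.

Lemma graded_Iq d f : Iq f -> Iq (T d f).
Proof.
apply: (graded_gen3 TD (k := n.+1)).
- by have := gradedXn n.+1 graded_a; rewrite mul1n.
- by have := gradedXn n.+1 graded_b; rewrite mul1n.
- by have := gradedXn n.+1 graded_c; rewrite mul1n.
Qed.

Lemma graded_bcn : graded T (n + n) ((b * c) ^+ n).
Proof.
have := gradedXn n (gradedM graded_b graded_c).
by have -> : ((1 + 1) * n = n + n)%N by lia.
Qed.

Section Generation.
Variable J : A -> Prop.
Hypothesis JD : forall g h, J g -> J h -> J (g + h).
Hypothesis JM : forall g h, J h -> J (g * h).
Hypothesis J_quotients : forall s t, (s + t <= n)%N ->
  exists2 d, J d & Iq (y ^+ s * z ^+ t * (b * c) ^+ n - x ^+ (s + t) * d).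

(** The ideal J stands for the one generated by chosen quotients f_(s,t); all
that matters is that it contains a quotient for each s, t. *)
Lemma colon_generated g :
  Iq (g * b) -> Iq (g * c) -> exists2 d, J d & Iq (g - d).
Proof.
move=> gb gc.
have [i [h [iI ugE]]] :
  exists i h, Iq i /\ g * u ^+ n.+1 = i + h * (b * c) ^+ n.
  by apply: (@colon_multiple u (- v) (- w)) => //; ring.
have [i' [h' [iI' xgE]]] :
  exists i h, Iq i /\ g * x ^+ n.+1 = i + h * (b * c) ^+ n.
  by apply: (@colon_multiple x (- y) (- z)) => //; ring.
pose g1 := T (n + n) g.
(* Below degree 2n, u^q g agrees with an element of Iq, and u is regular. *)
have gg1 : Iq (g - g1).
  apply: (@un_nzd n.+1).
  have -> : (g - g1) * u ^+ n.+1 = i - T (n + n) i; last exact/gen3B/graded_Iq.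
  have := congr1 (T (n + n)) ugE.
  rewrite (gradedXn n.+1 Tu) mul0n subn0 TD graded_bcn subnn T0 => E.
  by rewrite mulrBl E ugE; ring.
(* In degrees at least 3n + 1, x^q g1 is all that is left of x^q g. *)
pose h1 := T n.+1 h'.
have g1E : g1 * x ^+ n.+1 = T (n.+1 + (n + n)) i' + h1 * (b * c) ^+ n.
  have := congr1 (T (n.+1 + (n + n))) xgE.
  by rewrite (gradedXn n.+1 Tx) mul1n TD graded_bcn addnK addKn.
have [h2 [h3 [h4 h'E]]] : gen3 x u a h'.
  apply: (@numerator_in_xua h' (- i') g); first exact: gen3N.
  by rewrite xgE addKr.
have h1E : h1 = T n h2 * x + T n.+1 h3 * u + T n h4 * a.
  by rewrite /h1 h'E !TD Tx Tu graded_a subn1 subn0.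
(* K e is the ideal of the f such that x^e divides f (bc)^n modulo Iq, with a
   quotient in J. *)
pose K e f := exists2 d, J d & Iq (f * (b * c) ^+ n - x ^+ e * d).
have KD e f1 f2 : K e f1 -> K e f2 -> K e (f1 + f2).
  move=> [d1 d1J d1I] [d2 d2J d2I]; exists (d1 + d2); first exact: JD.
  have := gen3D d1I d2I; congr (Iq _); ring.
have KM e f1 f2 : K e f2 -> K e (f1 * f2).
  move=> [d2 d2J d2I]; exists (f1 * d2); first exact: JM.
  have := gen3Ml f1 d2I; congr (Iq _); ring.
have KI e f : gen3 a b c f -> K e f.
  move=> fI; have [d dJ _] := @J_quotients 0 0 (leq0n n); exists (0 * d);
    first exact: JM.
  by rewrite mul0r mulr0 subr0 [f * _]mulrC; apply: bc_colon.
have Kx f : K n f -> K n.+1 (f * x).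
  move=> [d dJ dI]; exists d => //.
  by have := gen3Mr x dI; congr (Iq _); rewrite exprS; ring.
have Kmon i1 j k : (i1 + j + k = n)%N -> K n (x ^+ i1 * y ^+ j * z ^+ k).
  move=> ijk; have [|d dJ dI] := @J_quotients j k; first by lia.
  exists d => //; have := gen3Ml (x ^+ i1) dI; congr (Iq _).
  have -> : x ^+ n = x ^+ i1 * x ^+ (j + k) by rewrite -exprD addnA ijk.
  ring.
have [d dJ dI] : K n.+1 h1.
  rewrite h1E; apply: (KD); last exact/KM/KI/gen3_1.
  apply: (KD); first by apply: Kx; apply: T_monomials => //;
    [exact: KD|exact: KM].
  apply: (@T_monomials _ (fun f => K n.+1 (f * u))).
  - by move=> f1 f2 Kf1 Kf2; rewrite mulrDl; apply: KD.
  - by move=> f1 f2 Kf2; rewrite -mulrA; apply: KM.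
  (* Multiplied by u, a monomial of degree n + 1 in x, y, z is x times one of
     degree n modulo I, by uy = vx + c and uz = wx - b. *)
  move=> [|i1] j k ijk; last first.
    have /Kmon/Kx/(KM _ u) : (i1 + j + k = n)%N by lia.
    by congr (K _ _); rewrite exprS; ring.
  case: j ijk => [|j] ijk; last first.
    have /Kmon jkK : (0 + j + k = n)%N by lia.
    have := KD _ _ _ (KM _ v _ (Kx _ jkK))
      (KI _ _ (gen3Ml (y ^+ j * z ^+ k) (gen3_3 a b c))).
    by congr (K _ _); rewrite !exprS; ring.
  case: k ijk => // k ijk.
  have /Kmon jkK : (0 + 0 + k = n)%N by lia.
  have := KD _ _ _ (KM _ w _ (Kx _ jkK))
    (KI _ _ (gen3Ml (- z ^+ k) (gen3_2 a b c))).
  by congr (K _ _); rewrite !exprS; ring.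
exists d => //; rewrite -[g](subrK g1) -addrA; apply: gen3D => //.
apply: (@xn_nzd n.+1); rewrite mulrBl g1E -addrA.
apply: gen3D; first exact: graded_Iq.
by move: dI; congr (Iq _); rewrite [d * _]mulrC.
Qed.
End Generation.

Local Open Scope classical_set_scope.

Lemma frobenius_colon_minors :
  let I := ideal_gen [set a; b; c] in
  let J := frobenius_power n.+1 I in
  let is_f (s t : nat) (f : A) :=
    eqmod_ideal J (y ^+ s * z ^+ t * (b * c) ^+ n) (x ^+ (s + t) * f) in
  (forall s t : nat, (s + t <= n)%N ->
     ideal_add J (ideal_gen [set x ^+ (s + t)])
       (y ^+ s * z ^+ t * (b * c) ^+ n))
  /\
  [/\ forall s t : nat, (s + t <= n)%N ->
        forall f f' : A, is_f s t f -> is_f s t f' -> eqmod_ideal J f f',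
      forall s t : nat, (s + t <= n)%N ->
        forall f : A, is_f s t f -> ideal_colon J I f
    & forall f : nat -> nat -> A,
        (forall s t : nat, (s + t <= n)%N -> is_f s t (f s t)) ->
        ideal_colon J I =
        ideal_add J
          (ideal_gen [set a | exists s t : nat, (s + t <= n)%N /\ a = f s t])].
Proof.
move=> I J.
rewrite /J /I frobenius_power3 // ideal_gen3 /eqmod_ideal /ideal_colon.
split=> [s t stn|].
  have [i [g [iI ->]]] := x_divides stn.
  exists i => //; exists (g * x ^+ (s + t)) => //.
  by apply/ideal_gen1; exists g.
split=> [s t _ f f' fI f'I|s t _ f fI h hI|f fI].
- exact: quotient_unique fI f'I.
- exact: quotient_colon hI fI.
apply/seteqP; split=> g.
  move=> gI.
  have [||s t stn|||d dJ gd] := @colon_generated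
    (ideal_gen [set a | exists s t, (s + t <= n)%N /\ a = f s t]) _ _ _ g.
  - exact: ideal_genD.
  - exact: ideal_genMl.
  - exists (f s t); last exact: fI.
    by apply: mem_ideal_gen; exists s, t.
  - exact/gI/gen3_2.
  - exact/gI/gen3_3.
  by exists (g - d) => //; exists d => //; rewrite subrK.
move=> [i iI [d dJ <-]] h hI; rewrite mulrDl; apply: gen3D; first exact: gen3Mr.
move: dJ; apply: (@ideal_gen_sub _ _ (fun d => Iq (d * h))).
- by rewrite mul0r; apply: gen3_0.
- by move=> g1 g2; rewrite mulrDl; apply: gen3D.
- by move=> g1 g2; rewrite -mulrA; apply: gen3Ml.
by move=> _ [s [t [stn ->]]]; apply: quotient_colon hI (fI _ _ stn).
Qed.
End Determinantal.

(** * The case of power series *)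

Lemma pchar_mpseries (n : nat) (R : comNzRingType) p :
  p \in [pchar R] -> p \in [pchar (mpseries n R)].
Proof.
move=> pR; rewrite inE (pcharf_prime pR); apply/eqP/mpsP => m.
have natE k :
    mpscoef (k%:R : mpseries n R) m = mpscoef (1 : mpseries n R) m *+ k.
  by elim: k => [|k IH]; rewrite ?mulr0n // mulrS mpscoefD IH mulrS.
by rewrite natE mulrn_pchar.
Qed.

Local Open Scope classical_set_scope.

Theorem proposition5p1 (F : fieldType) (p : nat) (charFp : p \in [pchar F]) :
  let A := mpseries 6 F in
  let u : A := mpsX F (@Ordinal 6 0 isT) in
  let v : A := mpsX F (@Ordinal 6 1 isT) in
  let w : A := mpsX F (@Ordinal 6 2 isT) in
  let x : A := mpsX F (@Ordinal 6 3 isT) in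
  let y : A := mpsX F (@Ordinal 6 4 isT) in
  let z : A := mpsX F (@Ordinal 6 5 isT) in
  let D1 := v * z - w * y in
  let D2 := w * x - u * z in
  let D3 := u * y - v * x in
  let I := ideal_gen [set D1; D2; D3] in
  forall e : nat,
  let q := (p ^ e)%N in
  let Iq := frobenius_power q I in
  let is_f (s t : nat) (f : A) :=
    eqmod_ideal Iq (y ^+ s * z ^+ t * (D2 * D3) ^+ (q - 1))
                   (x ^+ (s + t) * f) in
  (forall s t : nat, (s + t <= q - 1)%N ->
     ideal_add Iq (ideal_gen [set x ^+ (s + t)])
       (y ^+ s * z ^+ t * (D2 * D3) ^+ (q - 1)))
  /\
  [/\ forall s t : nat, (s + t <= q - 1)%N ->
        forall f f' : A, is_f s t f -> is_f s t f' -> eqmod_ideal Iq f f',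
      forall s t : nat, (s + t <= q - 1)%N ->
        forall f : A, is_f s t f -> ideal_colon Iq I f
    & forall f : nat -> nat -> A,
        (forall s t : nat, (s + t <= q - 1)%N -> is_f s t (f s t)) ->
        ideal_colon Iq I =
        ideal_add Iq
          (ideal_gen [set a | exists s t : nat,
                        (s + t <= q - 1)%N /\ a = f s t])].
Proof.
move=> A u v w x y z D1 D2 D3 I e q.
have qA : [pchar A].-nat q.
  have pA : p \in [pchar A] by apply: pchar_mpseries.
  by rewrite pnatX pnatE ?pA // (pcharf_prime pA).
have [n qE] : exists n, q = n.+1 by case/andP: qA; case: q => // n; exists n.
clearbody q; rewrite qE subn1 /= in qA *.
pose T := trunc (R := F) (@deg3 6 ix iy iz).
have TG i := @graded_var 6 F _ (@deg3D 6 ix iy iz) i.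
apply: (@frobenius_colon_minors _ u v w x y z n qA _ _ _ _ _ _ _ _ T).
- move=> f; exact: (@variable_nzd_minors 6 F iu iv iw ix iy iz _ f qA isT).
- move=> f /(gen3_swap_rows qA) fu.
  apply: (gen3_swap_rows qA).
  exact: (@variable_nzd_minors 6 F ix iy iz iu iv iw _ f qA isT).
- by move=> j k f; apply: binomial_nzd_gen2.
- by move=> k f; apply: power_shift_gen2.
- by move=> f; apply: variable_nzd_gen2.
- by move=> f; rewrite mulrA => /variable_nzd_gen3 fz;
  apply: variable_nzd_gen3 (fz _).
- by move=> r s; apply: binomial_reg.
- exact: minor_nzd_mod_minor.
- exact: trunc0.
- exact: truncD.
- exact: truncB.
- have := TG iu; rewrite /deg3 !mnm1E; exact.
- have := TG iv; rewrite /deg3 !mnm1E; exact.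
- have := TG iw; rewrite /deg3 !mnm1E; exact.
- have := TG ix; rewrite /deg3 !mnm1E; exact.
- have := TG iy; rewrite /deg3 !mnm1E; exact.
- have := TG iz; rewrite /deg3 !mnm1E; exact.
- move=> d J f JD JM Jmon.
  apply: (@order_monomials 6 F ix iy iz isT d J (T d f) JD JM Jmon).
  exact: supported_trunc.
Qed.
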